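(* Let $\mathcal{S}$ be a unipotent numerical monoid in $G$. The set $Rel_T(\mathcal{S})$ of all (two-sided) relative ideals of $\mathcal{S}$, with the product $(\mathcal{I},\mathcal{J})\mapsto\mathcal{I}\mathcal{J}$, is a monoid with identity element $\mathcal{S}$.
   Context: Setting: $n$ is a positive integer, $\mathbf{U}(n,\mathbb{C})$ is the group of upper triangular unipotent $n\times n$ complex matrices, and $G$ is a (Zariski) closed subgroup of it. $G_{\mathbb{Z}}$ is the group of matrices in $G$ with integer entries, and $G(\mathbb{N})$ is the monoid of matrices in $G_{\mathbb{Z}}$ all of whose entries lie in $\mathbb{N}=\{0,1,2,\dots\}$. Standing assumptions: the monoid $G(\mathbb{N})$ is finitely generated and $G_{\mathbb{Z}}$ is its group completion. A unipotent numerical monoid in $G$ is a finitely generated submonoid $\mathcal{S}\subseteq G(\mathbb{N})$ (containing the identity matrix) such that $G(\mathbb{N})\setminus\mathcal{S}$ is finite. For subsets of $G(\mathbb{N})$, $\mathcal{I}\mathcal{J}:=\{AB\mid A\in\mathcal{I},B\in\mathcal{J}\}$. A (two-sided) relative ideal of $\mathcal{S}$ is a subset $\mathcal{I}\subseteq G(\mathbb{N})$ with $\mathcal{I}\mathcal{S}\subseteq\mathcal{I}$ and $\mathcal{S}\mathcal{I}\subseteq\mathcal{I}$. *)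

(* Defs.v *)
From HB Require Import structures.
From mathcomp Require Import all_boot all_order all_algebra.
From mathcomp Require Import boolp classical_sets cardinality reals.
From mathcomp Require Import complex.
(* Not imported: its notations clash with those of MathComp-Analysis. *)
From mathcomp Require mpoly.

Set Implicit Arguments.
Unset Strict Implicit.
Unset Printing Implicit Defensive.

Import Order.TTheory GRing.Theory Num.Theory.
Local Open Scope classical_set_scope.
Local Open Scope ring_scope.

Definition is_monoid_on (T : Type) (M : set T) (op : T -> T -> T) (e : T) :
    Prop :=
  [/\ M e,
      forall x y, M x -> M y -> M (op x y),
      forall x y z, M x -> M y -> M z -> op x (op y z) = op (op x y) z,
      forall x, M x -> op e x = x
    & forall x, M x -> op x e = x].

Section UnipotentMonoids.
Variables (R : realType) (n : nat).
Local Notation C := (complex R).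
Local Notation mat := 'M[C]_n.

Definition unipotent_upper : set mat :=
  [set A | (forall i, A i i = 1) /\ (forall i j : 'I_n, (j < i)%N -> A i j = 0)].

(* The n * n polynomial variables are the matrix entries, in the order of
   mxvec. *)
Definition zariski_closed_in (U G : set mat) : Prop :=
  exists P : set (mpoly.mpoly (n * n) C),
    G = [set A | U A /\
           forall p, P p -> mpoly.meval (fun k => mxvec A ord0 k) p = 0].

Definition closed_subgroup (G : set mat) : Prop :=
  [/\ zariski_closed_in unipotent_upper G,
      G 1%:M,
      forall A B, G A -> G B -> G (A *m B)
    & forall A, G A -> G (invmx A)].

Definition int_points (G : set mat) : set mat :=
  [set A | G A /\ forall i j, exists z : int, A i j = z%:~R].

Definition nat_points (G : set mat) : set mat :=
  [set A | G A /\ forall i j, exists k : nat, A i j = k%:R].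

Definition is_submonoid (M : set mat) : Prop :=
  M 1%:M /\ forall A B, M A -> M B -> M (A *m B).

Definition fg_submonoid (M : set mat) : Prop :=
  exists X : set mat, finite_set X /\ M = smallest is_submonoid X.

Definition monoid_hom_on (H : groupType) (M : set mat) (f : mat -> H) : Prop :=
  f 1%:M = 1%g /\ forall A B, M A -> M B -> f (A *m B) = (f A * f B)%g.

(* The universal property of the inclusion of the monoid M in the group K:
   every homomorphism from M to a group extends uniquely to K.  Functions are
   total on mat, so values outside M and K are irrelevant. *)
Definition is_group_completion (M K : set mat) : Prop :=
  M `<=` K /\
  forall (H : groupType) (f : mat -> H), monoid_hom_on M f ->
    (exists g : mat -> H, monoid_hom_on K g /\ forall A, M A -> g A = f A) /\
    (forall g h : mat -> H,
       monoid_hom_on K g -> (forall A, M A -> g A = f A) ->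
       monoid_hom_on K h -> (forall A, M A -> h A = f A) ->
       forall A, K A -> g A = h A).

Definition unipotent_numerical_monoid (G S : set mat) : Prop :=
  [/\ S `<=` nat_points G,
      fg_submonoid S
    & finite_set (nat_points G `\` S)].

Definition mulset (I J : set mat) : set mat := [set A *m B | A in I & B in J].

Definition relative_ideal (G S I : set mat) : Prop :=
  [/\ I `<=` nat_points G, mulset I S `<=` I & mulset S I `<=` I].

Definition RelT (G S : set mat) : set (set mat) :=
  [set I | relative_ideal G S I].

End UnipotentMonoids.

(* Main.v *)
Require Import Defs.
From mathcomp Require Import all_boot all_order all_algebra.
From mathcomp Require Import boolp classical_sets cardinality reals.
From mathcomp Require Import complex.

Local Open Scope classical_set_scope.

(** Everything reduces to two facts: products of sets of matrices inherit associativity from matrix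
    multiplication ([mulsetA]), and both [S] and [nat_points G] are submonoids. Associativity lets a
    factor [S] be absorbed by the ideal next to it, so products of ideals are ideals. Since [S]
    contains the identity matrix, multiplying an ideal by [S] loses nothing, and the ideal
    conditions say that it adds nothing. *)

(** [smallest] is an intersection of submonoids, hence itself closed under products and containing
    1. *)
Lemma fg_submonoid_is_submonoid (R : realType) (n : nat)
    (M : set 'M[complex R]_n) :
  fg_submonoid M -> is_submonoid M.
Proof.
move=> [X [_ ->]]; split=> [N [[N1 _] _]|A B MA MB N NX]; first exact: N1.
have [[_ NM] _] := NX.
exact: NM (MA N NX) (MB N NX).
Qed.

Lemma mulsetA (R : realType) (n : nat) (I J K : set 'M[complex R]_n) :
  mulset I (mulset J K) = mulset (mulset I J) K.
Proof.
apply/seteqP; split=> [_ [A IA [_ [B JB [C KC <-]] <-]]|].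
  by rewrite mulmxA; exists (A *m B)%R => //; [exists A => //; exists B|exists C].
move=> _ [_ [A IA [B JB <-]] [C KC <-]].
by rewrite -mulmxA; exists A => //; exists (B *m C)%R => //; exists B => //; exists C.
Qed.

Lemma mulsetS (R : realType) (n : nat) (I I' J J' : set 'M[complex R]_n) :
  I `<=` I' -> J `<=` J' -> mulset I J `<=` mulset I' J'.
Proof.
move=> II' JJ' _ [A IA [B JB <-]].
by exists A; [exact: II'|exists B; [exact: JJ'|]].
Qed.

Lemma mulset_sub (R : realType) (n : nat) (M I J : set 'M[complex R]_n) :
  is_submonoid M -> I `<=` M -> J `<=` M -> mulset I J `<=` M.
Proof.
by move=> [_ MM] IM JM _ [A IA [B JB <-]]; apply: MM; [exact: IM|exact: JM].
Qed.

Theorem theorem4p4 (R : realType) (n : nat) (n_gt0 : (0 < n)%N)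
    (G : set 'M[complex R]_n)
    (G_closed : closed_subgroup G)
    (GN_fg : fg_submonoid (nat_points G))
    (GZ_completion : is_group_completion (nat_points G) (int_points G))
    (S : set 'M[complex R]_n)
    (S_numerical : unipotent_numerical_monoid G S) :
  is_monoid_on (RelT G S) (@mulset R n) S.
Proof.
have [SG /fg_submonoid_is_submonoid Smon _] := S_numerical.
have Gmon := fg_submonoid_is_submonoid _ _ _ GN_fg.
have S1 : S 1%:M%R by case: Smon.
split.
- by split=> //; exact: mulset_sub.
- move=> I J [IG IS SI] [JG JS SJ]; split; first exact: mulset_sub.
    (* (IJ)S = I(JS) lies in IJ because J absorbs S on the right; symmetrically, S(IJ) = (SI)J lies
       in IJ. *)
    by rewrite -mulsetA; apply: mulsetS.
  by rewrite mulsetA; apply: mulsetS.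
- by move=> I J K _ _ _; exact: mulsetA.
- move=> I [_ _ SI]; apply/seteqP; split=> // A IA.
  (* The inclusion of I in SI: write A = 1 A with 1 in S. *)
  by exists 1%:M%R => //; exists A => //; rewrite mul1mx.
- move=> I [_ IS _]; apply/seteqP; split=> // A IA.
  by exists A => //; exists 1%:M%R => //; rewrite mulmx1.
Qed.
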